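(* Given two complex numbers $\omega^{\mathrm{old}}$ and $\omega^{\mathrm{new}}$ with negative imaginary parts, it holds that $$\left\|s*h[\omega^{\mathrm{old}}]-s*h[\omega^{\mathrm{new}}]\right\|_{L^\infty(\mathbb{R})}\leq\left\|h[\omega^{\mathrm{old}}]-h[\omega^{\mathrm{new}}]\right\|_{L^\infty(\mathbb{R})}\|s\|_{L^1(\mathbb{R})}$$ for all $s\in L^1(\mathbb{R})$.
   Context: For a complex number $\omega$ with negative imaginary part, the kernel $h[\omega]:\mathbb{R}\to\mathbb{R}$ is defined by $h[\omega](t)=0$ for $t<0$ and $h[\omega](t)=c_\omega\,e^{\Im(\omega)t}\sin(\Re(\omega)t)$ for $t\geq0$, where $c_\omega$ is some real constant. The symbol $*$ denotes convolution on $\mathbb{R}$. *)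

(* Defs.v *)
From mathcomp Require Import all_boot all_order all_algebra.
From mathcomp Require Import complex.
From mathcomp Require Import all_classical all_reals all_analysis.

Set Implicit Arguments.
Unset Strict Implicit.
Unset Printing Implicit Defensive.

Import Order.TTheory GRing.Theory Num.Theory.
Import numFieldNormedType.Exports.

Local Open Scope classical_set_scope.
Local Open Scope ring_scope.
Local Open Scope complex_scope.

(* [c w] is the real constant written c_w in the formula for the kernel. *)
Definition damped_kernel (R : realType) (c : R[i] -> R) (w : R[i]) (t : R) : R :=
  if t < 0 then 0
  else c w * expR (complex.Im w * t) * sin (complex.Re w * t).

(* [Rintegral] is total, with value 0 where the Lebesgue integral is infinite;
   for [f] in L^1 and [g] bounded and measurable, the integrand is integrable
   for every [t]. *)
Definition convolution (R : realType) (f g : R -> R) (t : R) : R :=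
  \int[@lebesgue_measure R]_u (f u * g (t - u)).

(* Main.v *)
Require Import Defs.
From mathcomp Require Import all_boot all_order all_algebra.
From mathcomp Require Import complex.
From mathcomp Require Import all_classical all_reals all_analysis.
From mathcomp Require Import measurable_realfun ess_sup_inf.

(** Translation invariance of the measure is avoided: the sine vanishes at [0],
    so the kernels are continuous across the origin, and the difference [d] of
    the two kernels, being continuous, is dominated by its essential supremum
    at every point.  Hence [|s u * d (t - u)|] is at most [||d||_oo |s u|] for
    all [t] and [u], and it remains to integrate in [u].  Boundedness of the
    kernels makes all convolution integrals finite, which allows subtracting
    them. *)

Import Order.TTheory GRing.Theory Num.Theory.
Import numFieldNormedType.Exports.

Local Open Scope classical_set_scope.
Local Open Scope ring_scope.
Local Open Scope complex_scope.

Lemma lebesgue_measure_setT_gt0 (R : realType) :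
  (0 < @lebesgue_measure R [set: R])%E.
Proof. by rewrite -set_itvNyy lebesgue_measure_itv/= ltry. Qed.

(** By definition the norm at exponent [+oo] is an essential supremum only when the whole space has
    positive measure. *)
Lemma Lnormy_lebesgueE {R : realType} (f : R -> \bar R) :
  ('N[@lebesgue_measure R]_+oo[f] = ess_sup lebesgue_measure (abse \o f))%E.
Proof. by rewrite unlock lebesgue_measure_setT_gt0. Qed.

(** If [f] exceeded its norm at [x], it would do so by continuity on a ball around [x]; that ball
    would be negligible, yet it has positive length. *)
Lemma continuous_le_Lnormy {R : realType} (f : R -> R) (x : R) :
  continuous f ->
  (`|f x|%:E <= 'N[@lebesgue_measure R]_+oo[EFin \o f])%E.
Proof.
move=> cf; rewrite leNgt; apply/negP; rewrite Lnormy_lebesgueE => fx_gt.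
have := ess_sup_ge (@lebesgue_measure R) (abse \o (EFin \o f)).
move: fx_gt; set M := ess_sup _ _; case: M => [M||] //=; last first.
  (* An essential supremum equal to [-oo] would make the whole line negligible. *)
  move=> _ [N [mN N0 subN]]; have := lebesgue_measure_setT_gt0 R.
  suff -> : [set: R] = N by rewrite N0 ltxx.
  by apply/seteqP; split => // y _; apply: subN => /=; rewrite leeNy_eq.
rewrite lte_fin => fx_gt [N [mN N0 subN]].
have cnf : {for x, continuous (fun y => `|f y|)}.
  by apply: continuous_comp; [exact: cf|exact: norm_continuous].
have : \forall y \near x, M < `|f y|.
  by apply: (cvgr_gt _ cnf).
move=> /nbhs_ballP[e /= e0 ballM].
have := lebesgue_measure_ball x (ltW e0).
suff -> : lebesgue_measure (ball x e) = 0%E.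
  by case => /esym/eqP; rewrite mulrn_eq0/= gt_eqF.
apply: (subset_measure0 _ mN _ N0) => [|y /ballM yM].
  by rewrite ball_itv; exact: measurable_itv.
by apply: subN => /=; apply/negP; rewrite -ltNge lte_fin.
Qed.

(** Both branches merge because the sine factor vanishes at 0. Continuity and boundedness are read
    off this single formula. *)
Lemma damped_kernel_maxE {R : realType} (c : R[i] -> R) (w : R[i]) (t : R) :
  damped_kernel c w t =
  c w * expR (complex.Im w * Num.max t 0) * sin (complex.Re w * Num.max t 0).
Proof.
rewrite /damped_kernel; case: ltP => // _.
by rewrite !mulr0 sin0 mulr0.
Qed.

Lemma continuous_damped_kernel {R : realType} (c : R[i] -> R) (w : R[i]) :
  continuous (damped_kernel c w).
Proof.
have cmax : continuous (fun t : R => Num.max t 0).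
  by move=> t; apply: continuous_max => //; exact: cvg_cst.
have cmulmax (a : R) : continuous (fun t : R => a * Num.max t 0).
  by move=> t; apply: cvgM; [exact: cvg_cst|exact: cmax].
rewrite (funext (damped_kernel_maxE c w)) => t.
apply: (@cvgM _ R^o); first apply: (@cvgM _ R^o).
- exact: cvg_cst.
- by apply: continuous_comp; [exact: cmulmax|exact: continuous_expR].
- by apply: continuous_comp; [exact: cmulmax|exact: continuous_sin].
Qed.

Lemma normr_damped_kernel_le {R : realType} (c : R[i] -> R) (w : R[i]) (t : R) :
  complex.Im w <= 0 -> `|damped_kernel c w t| <= `|c w|.
Proof.
move=> w0; rewrite damped_kernel_maxE !normrM -[leRHS]mulr1 -mulrA.
apply: ler_wpM2l => //; rewrite -[leRHS]mulr1; apply: ler_pM => //.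
  (* The exponent is a product of a nonpositive and a nonnegative factor, so the exponential is at
     most 1. *)
  rewrite ger0_norm ?expR_ge0// -expR0 ler_expR.
  by rewrite mulr_le0_ge0// le_max lexx orbT.
by rewrite ler_norml sin_geN1 sin_le1.
Qed.

Lemma integrable_convolution {R : realType} (s g : R -> R) (M t : R) :
  s \in Lfun (@lebesgue_measure R) 1%E -> continuous g ->
  (forall x, `|g x| <= M) ->
  (@lebesgue_measure R).-integrable setT (EFin \o (fun u => s u * g (t - u))).
Proof.
move=> /Lfun1_integrable si cg gM.
have -> : EFin \o (fun u => s u * g (t - u)) =
    ((EFin \o s) \* (EFin \o (fun u => g (t - u)%R)))%E by [].
apply: integrableMl => //.
  apply: continuous_measurable_fun => u; apply: continuous_comp; last exact: cg.
  by apply: cvgB; [exact: cvg_cst|exact: cvg_id].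
(* Boundedness is phrased near [+oo]: every [y] above the threshold [M] must be a bound. *)
exists M; split; first exact: num_real.
by move=> y My u _ /=; rewrite (le_trans (gM _))// ltW.
Qed.

Lemma convolutionBr {R : realType} (s g h : R -> R) (Mg Mh : R) (t : R) :
  s \in Lfun (@lebesgue_measure R) 1%E ->
  continuous g -> (forall x, `|g x| <= Mg) ->
  continuous h -> (forall x, `|h x| <= Mh) ->
  convolution s g t - convolution s h t = convolution s (g \- h) t.
Proof.
move=> hs cg gM ch hM; rewrite /convolution -RintegralB//.
- by apply: eq_Rintegral => u _; rewrite mulrBr.
- exact: integrable_convolution gM.
- exact: integrable_convolution hM.
Qed.

(* Young's inequality for the exponents (1, oo). *)
Lemma normr_convolution_le {R : realType} (s g : R -> R) (M t : R) :
  s \in Lfun (@lebesgue_measure R) 1%E ->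
  continuous g -> (forall x, `|g x| <= M) ->
  (`|convolution s g t|%:E <=
   'N[@lebesgue_measure R]_+oo[EFin \o g]
     * 'N[@lebesgue_measure R]_1[EFin \o s])%E.
Proof.
move=> hs cg gM; have sgi := integrable_convolution s g M t hs cg gM.
have /Lfun1_integrable/measurable_int ms := hs.
have mas : measurable_fun setT (abse \o (EFin \o s)) by exact: measurableT_comp.
rewrite EFin_normr_Rintegral//.
apply: le_trans (le_abse_integral _ measurableT (measurable_int _ sgi)) _.
(* The norm of [g] enters the integral as a constant factor, which leaves a pointwise comparison of
   integrands. *)
rewrite Lnorm1 -ge0_integralZl//; last exact: Lnorm_ge0.
apply: ge0_le_integral => //.
- by apply: measurableT_comp => //; exact: measurable_int sgi.
- exact: measurable_funeM.
move=> u _; rewrite /= normrM EFinM muleC lee_wpmul2r//.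
exact: (continuous_le_Lnormy g).
Qed.

Theorem theorem5p1 (R : realType) (c : R[i] -> R) (w_old w_new : R[i])
    (h_old : complex.Im w_old < 0) (h_new : complex.Im w_new < 0) (s : R -> R)
    (hs : s \in Lfun (@lebesgue_measure R) 1%E) :
  ('N[@lebesgue_measure R]_+oo[
       EFin \o (convolution s (damped_kernel c w_old)
                \- convolution s (damped_kernel c w_new))%R]
   <= 'N[@lebesgue_measure R]_+oo[
         EFin \o (damped_kernel c w_old \- damped_kernel c w_new)%R]
      * 'N[@lebesgue_measure R]_1[EFin \o s])%E.
Proof.
(* The estimate is proved at every [t], with no exceptional null set. *)
rewrite [leLHS]Lnormy_lebesgueE; apply/ess_supP/nearW => t /=.
have bound w (w0 : complex.Im w < 0) x := normr_damped_kernel_le c w x (ltW w0).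
rewrite (convolutionBr _ _ _ _ _ _ hs (continuous_damped_kernel c w_old) (bound _ h_old)
  (continuous_damped_kernel c w_new) (bound _ h_new)).
(* The triangle inequality gives this bound on the difference of the kernels. It secures
   integrability; the constant in the estimate is the norm. *)
apply: (normr_convolution_le s _ (`|c w_old| + `|c w_new|)) => //.
  by move=> x; apply: cvgB; exact: continuous_damped_kernel.
by move=> x; rewrite (le_trans (ler_normB _ _))// lerD// bound.
Qed.
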